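(* There is an absolute constant $C_1>0$ such that the following holds. Let $n\ge1$, let $m_1,\dots,m_n$ be arbitrary (linear or non-linear) real-valued measurements, i.e. real-valued functions $f\mapsto m_i(f)$ of the function $f$, and let $P:\mathbb{R}^n\to L^2([0,1])$ be a linear operator. For each $f$ put $\hat f=P(m_1(f),\dots,m_n(f))$. Then for some $f\in\mathcal{H}$, $$\|f-\hat f\|\ge \frac{C_1}{\sqrt n}.$$
   Context: $\mathcal{H}=\{\chi_{[0,t]} : t\in[0,1]\}\subset L^2([0,1])$, where $\chi_E$ is the characteristic function of $E$, and $\|\cdot\|$ is the norm of $L^2([0,1])$. The measurements are followed by the processing operator $P$, giving the reconstruction $\hat f$ of $f$. *)

(* Defs.v *)
From HB Require Import structures.
From mathcomp Require Import all_boot all_order all_algebra.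
From mathcomp Require Import all_classical all_reals all_analysis.

Set Implicit Arguments.
Unset Strict Implicit.
Unset Printing Implicit Defensive.

Import Order.TTheory GRing.Theory Num.Theory.
Import numFieldNormedType.Exports.

Local Open Scope classical_set_scope.
Local Open Scope ring_scope.

(* Lebesgue measure on [0,1], carried by the whole line with [0,1]
   of full measure. *)
Definition leb01 (R : realType) : {measure set (measurableTypeR R) -> \bar R} :=
  mrestr lebesgue_measure (@measurable_itv R `[0, 1]).

(* The elements are classes of functions modulo a.e. equality; the coercion of
   a class to a function picks a representative, so it should only be used in
   ways that are invariant under a.e. equality. *)
Definition L2 (R : realType) : Type := LspaceType2 (leb01 R).

Definition L2fun (R : realType) (f : L2 R) : measurableTypeR R -> R :=
  aqEqMfun_to_fun f.
Coercion L2fun : L2 >-> Funclass.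

(* ||f - g||; extended-real valued in the library, finite for f and g in L2 *)
Definition L2dist (R : realType) (f g : L2 R) : \bar R :=
  'N[leb01 R]_2%:E[(fun x => (f x - g x)%:E)]%E.

(* Equality in L2 is a.e. equality of representatives, hence linearity of an
   L2-valued map is the usual identity, a.e. for each choice of a, u, v. *)
Definition L2_linear (R : realType) (V : lmodType R) (P : V -> L2 R) : Prop :=
  forall (a : R) (u v : V),
    {ae leb01 R, forall x, P (a *: u + v) x = a * P u x + P v x}.

Definition calH (R : realType) : set (L2 R) :=
  [set f | exists2 t : R, 0 <= t <= 1 &
     {ae leb01 R, forall x, f x = \1_(`[0, t]) x}].

(* Main.v *)
From HB Require Import structures.
Require Import Defs.
From mathcomp Require Import all_boot all_order all_algebra.
From mathcomp Require Import all_classical all_reals all_analysis.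
From mathcomp Require Import measurable_realfun ring lra.

(** The reconstructions [P (m f)] lie in an [n]-dimensional subspace [V] of
    L^2([0,1]), so the claim is a lower bound for the Kolmogorov [n]-width of
    the indicators [h_t] of [[0,t]].  Only the linearity of [P] matters; the
    measurements merely select a point of [V] for each [f].

    Put [N = 2n] and cut ]0,1] into the [N] cells ]j/N,(j+1)/N].  Suppose that
    each [h_(k/N)], [k = 0..N], is at distance at most [d] from some [p_k] in
    [V].  The differences [h_((k+1)/N) - h_(k/N)] are the indicators of the
    cells: they are pairwise orthogonal, of squared norm 1/N.  Record a function
    by its vector of cell averages, [N] times its integrals over the cells
    ([cellcoef]).  The cell averages of the differences then form the identity
    matrix, while those of [p_(k+1) - p_k] form a matrix [A] of rank at most
    [n].  Two estimates of the Frobenius norm of [1 - A] are compared.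

    - Below ([subr_rank_le_frobenius]): [||1 - A||^2 >= N - rank A].  If [Q] is
      the orthogonal projection onto the row space of [A], then [A Q = A] and
      [tr Q = rank A]; expanding [||A - Q||^2 >= 0] gives
      [||A||^2 - 2 tr A + rank A >= 0].

    - Above ([sum_sqr_cellcoef]): by the Cauchy-Schwarz inequality on each cell
      (Bessel's inequality for the indicators of the cells), the vector of cell
      averages of [h_(k/N) - p_k] has squared norm at most [N d^2], so that each
      row of [1 - A], a difference of two such vectors, has squared norm at most
      [4 N d^2].

    Hence [N - n <= 4 N^2 d^2], i.e. [n <= 16 n^2 d^2], which fails for
    [d = 1 / (5 sqrt n)]. *)

Import Order.TTheory GRing.Theory Num.Theory.
Import numFieldNormedType.Exports.

Set Implicit Arguments.
Unset Strict Implicit.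
Unset Printing Implicit Defensive.

Local Open Scope classical_set_scope.
Local Open Scope ring_scope.

(** * Frobenius distance from the identity to a matrix of small rank *)

Lemma mxtrace_mul_trmx (R : realFieldType) (m n : nat) (A : 'M[R]_(m, n)) :
  \tr (A *m A^T) = \sum_i \sum_j A i j ^+ 2.
Proof.
rewrite /mxtrace; apply: eq_bigr => i _; rewrite mxE.
by apply: eq_bigr => j _; rewrite mxE expr2.
Qed.

(** Over an ordered field the Gram matrix of independent rows is invertible. *)
Lemma gram_unitmx (R : realFieldType) (m n : nat) (B : 'M[R]_(m, n)) :
  row_free B -> B *m B^T \in unitmx.
Proof.
move=> Bfree; rewrite -row_free_unit -kermx_eq0; apply/eqP/row_matrixP => i.
rewrite row0; set v := row i _.
have vBB : v *m (B *m B^T) = 0 by rewrite -row_mul mulmx_ker row0.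
have /eqP : \tr ((v *m B) *m (v *m B)^T) = 0.
  by rewrite trmx_mul !mulmxA -(mulmxA v) vBB mul0mx mxtrace0.
rewrite mxtrace_mul_trmx big_ord1 psumr_eq0; last by move=> *; exact: sqr_ge0.
move=> /allP vB0; apply: (row_free_inj Bfree); rewrite mul0mx.
apply/rowP => j; rewrite [RHS]mxE; apply/eqP; rewrite -sqrf_eq0.
by rewrite -{1}(ord1 0); exact: (vB0 j (mem_index_enum j)).
Qed.

(** The orthogonal projection onto the row space of [A] is
    [B^T (B B^T)^-1 B], for any basis [B] of that row space. *)
Lemma proj_rowspace (R : realFieldType) (N : nat) (A : 'M[R]_N) :
  exists Q : 'M[R]_N,
    [/\ Q^T = Q, Q *m Q = Q, A *m Q = A & \tr Q = (\rank A)%:R].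
Proof.
have [B Bfree AB] : exists2 B : 'M[R]_(\rank A, N), row_free B & (A <= B)%MS.
  by exists (row_base A); rewrite ?row_base_free ?eq_row_base.
pose G := B *m B^T.
have Gu : G \in unitmx by exact: gram_unitmx.
have GT : (invmx G)^T = invmx G by rewrite trmx_inv trmx_mul trmxK.
have GBK m (M : 'M[R]_(_, m)) : invmx G *m (B *m (B^T *m M)) = M.
  by rewrite (mulmxA B) -/G mulmxA mulVmx// mul1mx.
exists (B^T *m invmx G *m B); split.
- by rewrite !trmx_mul trmxK GT mulmxA.
- by rewrite -!mulmxA GBK.
- have [M AM] := submxP AB.
  have : M *m B *m (B^T *m invmx G *m B) = M *m B.
    by rewrite -!mulmxA (mulmxA B) -/G (mulmxA G) mulmxV// mul1mx.
  by rewrite -AM.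
- by rewrite mxtrace_mulC mulmxA -/G mulmxV// mxtrace1.
Qed.

(** A special case of the Eckart-Young inequality. *)
Lemma subr_rank_le_frobenius (R : realFieldType) (N : nat) (A : 'M[R]_N) :
  N%:R - (\rank A)%:R <= \sum_i \sum_j ((1%:M - A) i j) ^+ 2.
Proof.
have [Q [QT QQ AQ trQ]] := proj_rowspace A.
have /(_ (A - Q)) h0 (M : 'M[R]_N) : 0 <= \tr (M *m M^T).
  by rewrite mxtrace_mul_trmx; do 2 apply: sumr_ge0 => ? _; exact: sqr_ge0.
have QA : \tr (Q *m A^T) = \tr A by rewrite -mxtrace_tr trmx_mul trmxK QT AQ.
rewrite -mxtrace_mul_trmx.
move: h0; rewrite !(raddfB, mulmxBl, mulmxBr)/= trmx1 QT !(mul1mx, mulmx1).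
rewrite AQ QQ QA trQ mxtrace_tr mxtrace1; lra.
Qed.

Lemma linear_rV_mulmx (R : realFieldType) (m n : nat)
    (f : 'rV[R]_m -> 'rV[R]_n) :
  (forall a u v, f (a *: u + v) = a *: f u + f v) ->
  exists M : 'M[R]_(m, n), forall u, f u = u *m M.
Proof.
move=> flin.
pose g := HB.pack_for {linear 'rV[R]_m -> 'rV[R]_n} f
  (GRing.isLinear.Build R 'rV[R]_m 'rV[R]_n *:%R f flin).
by exists (lin1_mx g) => u; rewrite (mul_rV_lin1 g).
Qed.

(** * Bessel's inequality for disjoint sets of equal measure *)

(** Cauchy-Schwarz against a constant. *)
Lemma sqr_Rintegral_le d (T : measurableType d) (R : realType)
    (mu : {measure set T -> \bar R}) (D : set T) (c : R) (f : T -> R) :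
  measurable D -> mu D = c%:E -> 0 < c ->
  mu.-integrable D (EFin \o f) ->
  mu.-integrable D (EFin \o (fun x => f x ^+ 2)) ->
  (\int[mu]_(x in D) f x) ^+ 2 <= c * \int[mu]_(x in D) (f x ^+ 2).
Proof.
move=> mD muD c0 if1 if2; set I := Rintegral mu D f.
have icst r : mu.-integrable D (EFin \o (fun=> r : R)).
  apply/integrableP; split; first exact/measurable_EFinP.
  under eq_integral do rewrite -/(cst `|r|%:E _).
  by rewrite integral_cst// muD ltry.
(* With [a] the mean of [f] on [D], integrate [f^2 >= 2 a f - a^2]. *)
rewrite -ler_pdivrMl//; pose a := I / c.
have iaf := integrableZl mD (2 * a) if1.
have -> : c^-1 * I ^+ 2 = \int[mu]_(x in D) (2 * a * f x - a ^+ 2).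
  rewrite RintegralB// RintegralZl// Rintegral_cst// muD/= -/I /a; field.
  by rewrite gt_eqF.
apply: le_Rintegral => //.
  by apply: (integrableB mD iaf (icst _)).
move=> x _; have := sqr_ge0 (f x - a); lra.
Qed.

Lemma bessel_disjoint d (T : measurableType d) (R : realType)
    (mu : {measure set T -> \bar R}) (N : nat) (F : 'I_N -> set T) (c : R)
    (f : T -> R) :
  (forall i, measurable (F i)) -> trivIset setT F ->
  (forall i, mu (F i) = c%:E) -> 0 < c ->
  mu.-integrable setT (EFin \o f) ->
  mu.-integrable setT (EFin \o (fun x => f x ^+ 2)) ->
  \sum_i (\int[mu]_(x in F i) f x) ^+ 2 <= c * \int[mu]_x (f x ^+ 2).
Proof.
move=> mF tF muF c0 if1 if2.
apply: (@le_trans _ _ (\sum_i c * \int[mu]_(x in F i) (f x ^+ 2))).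
  apply: ler_sum => i _; apply: sqr_Rintegral_le => //.
    exact: (integrableS measurableT).
  exact: (integrableS measurableT).
rewrite -mulr_sumr ler_pM2l//.
have mf2 := measurable_int mu if2.
rewrite -lee_fin -sumEFin.
have fin D : measurable D ->
    (\int[mu]_(x in D) (f x ^+ 2)%:E)%E \is a fin_num.
  move=> mD; apply: integrable_fin_num => //.
  exact: (integrableS measurableT).
rewrite fineK ?fin//.
under eq_bigr do rewrite fineK ?fin//.
rewrite -(@ge0_integral_bigsetU _ _ _ mu _ F _ (index_enum 'I_N))//=.
- apply: ge0_subset_integral => //.
  + by apply: bigsetU_measurable.
  + by move=> x _; rewrite lee_fin sqr_ge0.
- exact: index_enum_uniq.
- by apply: sub_trivIset tF.
- by apply: measurable_funS mf2.
- by move=> x _; rewrite lee_fin sqr_ge0.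
Qed.

(** * Elements of L^2([0,1]) *)

(** Stated for [leb01] itself, so that filter lemmas apply to properties that
    hold [leb01]-almost everywhere. *)
#[local] Instance leb01_ae_filter (R : realType) :
  Filter (nbhs (almost_everywhere (leb01 R))).
Proof. exact: ae_filter_ringOfSetsType. Qed.

Lemma leb01T_fin_num (R : realType) : leb01 R setT \is a fin_num.
Proof.
by rewrite /leb01 /= /mrestr setTI lebesgue_measure_itv/= lte_fin ltr01.
Qed.

Lemma L2_Lfun2 (R : realType) (f : L2 R) : (f : R -> R) \in Lfun (leb01 R) 2%:E.
Proof.
rewrite inE; apply/andP; split; rewrite inE /=.
  exact: (@measurable_funPT _ _ _ (measurableTypeR R) (repr _)).
exact: Lebesgue_finite.
Qed.

Lemma L2B_Lfun2 (R : realType) (f g : L2 R) :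
  (fun x => f x - g x) \in Lfun (leb01 R) 2%:E.
Proof.
have [_ add] := @Lfun_addr_closed _ _ _ (leb01 R) 2%:E (lee1n 2).
have opp := @Lfun_oppr_closed _ _ _ (leb01 R) 2%:E.
exact: (add _ _ (L2_Lfun2 f) (opp _ (L2_Lfun2 g))).
Qed.

(** Every square-integrable function has a class in L^2. *)
Lemma Lfun2_L2 (R : realType) (g : measurableTypeR R -> R) :
  g \in Lfun (leb01 R) 2%:E ->
  exists f : L2 R, {ae leb01 R, forall x, f x = g x}.
Proof.
rewrite inE => /andP[]; rewrite !inE => mg fing.
pose T := measurableTypeR R.
have mg' : @measurable_fun _ _ T T setT g by exact: mg.
pose gm : {mfun T >-> T} := HB.pack g (isMeasurableFun.Build _ _ T T g mg').
pose q : {mfun_ leb01 R, T >-> T} := (\pi gm)%qT.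
have qg : {ae leb01 R, forall x, (repr q : R -> R) x = g x}.
  have /eqP : repr q = gm %[mod {mfun_ leb01 R, T >-> T}]%qT by rewrite reprK.
  rewrite eqmodE => /asboolP.
  by apply: filterS => x /(_ I).
have finq : finite_norm (leb01 R) 2 (repr q : R -> R).
  rewrite /finite_norm.
  move: fing; rewrite /= /finite_norm; congr (_ < _)%E.
  rewrite unlock; congr poweR.
  have mpow (h : measurableTypeR R -> R) : measurable_fun setT h ->
      measurable_fun setT (fun x => `|(EFin \o h) x| `^ 2)%E.
    move=> /measurable_EFinP mh; apply: (measurableT_comp (measurable_poweR _)).
    exact: measurableT_comp.
  apply: ae_eq_integral => //.
  - exact: mpow.
  - by apply: mpow; exact: (@measurable_funPT _ _ _ T (repr q)).
  - by move: qg; apply: filterS => x /= -> _.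
pose f : L2 R := HB.pack_for (L2 R) q
  (isFinLebesgue.Build _ _ _ (leb01 R) 2%:E (lee1n 2) q finq).
by exists f.
Qed.

Lemma indic_Lfun2 (R : realType) (A : set (measurableTypeR R)) :
  measurable A -> (\1_A : measurableTypeR R -> R) \in Lfun (leb01 R) 2%:E.
Proof.
move=> mA; rewrite inE; apply/andP; split; rewrite inE /=.
  exact: measurable_indic.
rewrite /finite_norm unlock poweR_lty//.
have -> : (\int[leb01 R]_x `|(EFin \o (\1_A : _ -> R)) x| `^ 2)%E =
          (\int[leb01 R]_x (\1_A x)%:E)%E.
  apply: eq_integral => x _ /=; rewrite indicE.
  by case: (x \in A); rewrite ?normr1 ?powR1 ?normr0 ?powR0.
rewrite integral_indic// setIT.
have := leb01T_fin_num R; rewrite ge0_fin_numE//; apply: le_lt_trans.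
by rewrite le_measure// inE.
Qed.

Lemma calH_indic (R : realType) (t : R) : 0 <= t <= 1 ->
  exists2 f : L2 R, calH f & {ae leb01 R, forall x, f x = \1_(`[0, t]) x}.
Proof.
move=> t01.
have [f ft] : exists f : L2 R, {ae leb01 R, forall x, f x = \1_(`[0, t]) x}.
  by apply: Lfun2_L2; apply: indic_Lfun2; exact: measurable_itv.
by exists f => //; exists t.
Qed.

Lemma Rintegral_sqr_L2dist (R : realType) (f g : L2 R) (d : R) :
  0 <= d -> (L2dist f g <= d%:E)%E ->
  \int[leb01 R]_x ((f x - g x) ^+ 2) <= d ^+ 2.
Proof.
move=> d0 fgd; rewrite -lee_fin /Rintegral fineK; last first.
  apply: integrable_fin_num => //.
  exact: Lfun2_integrable_sqr (L2B_Lfun2 f g).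
have -> : (\int[leb01 R]_x ((f x - g x) ^+ 2)%:E = L2dist f g `^ 2)%E.
  rewrite poweR_Lnorm//; apply: eq_integral => x _.
  by rewrite /= powR_mulrn// -normrX ger0_norm// sqr_ge0.
have -> : (d ^+ 2)%:E = (d%:E `^ 2)%E by rewrite poweR_EFin powR_mulrn.
by apply: gt0_ler_poweR => //; rewrite in_itv/= leey andbT ?lee_fin ?Lnorm_ge0.
Qed.

(** * Cells and cell averages *)

(** The [j]-th of the [N] cells of equal length of ]0,1], for [j < N].  Leaving
    out the left end makes the cells disjoint, and the cells below [k] are
    exactly those contained in [[0,k/N]]. *)
Definition cell (R : realType) (N j : nat) : set (measurableTypeR R) :=
  `]j%:R / N%:R, j.+1%:R / N%:R].
Arguments cell : clear implicits.

Lemma measurable_cell (R : realType) (N j : nat) : measurable (cell R N j).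
Proof. exact: measurable_itv. Qed.

Lemma leb01_cell (R : realType) (N j : nat) : (j < N)%N ->
  leb01 R (cell R N j) = (N%:R^-1)%:E.
Proof.
move=> jN; have N0 : 0 < N%:R :> R by rewrite ltr0n (leq_ltn_trans _ jN).
rewrite /leb01 /= /mrestr setIidl; last first.
  move=> x; rewrite /cell /= !in_itv/= => /andP[/ltW jx xj]; apply/andP; split.
    by rewrite (le_trans _ jx)// divr_ge0.
  by rewrite (le_trans xj)// ler_pdivrMr// mul1r ler_nat.
rewrite lebesgue_measure_itv/= lte_fin ltr_pM2r ?invr_gt0// ltr_nat ltnSn.
by rewrite -EFinD -mulrBl -natrB// subSnn mul1r.
Qed.

Lemma trivIset_cell (R : realType) (N : nat) :
  trivIset setT (fun j : 'I_N => cell R N j).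
Proof.
move=> i j _ _ [x []]; rewrite /cell /= !in_itv/= => /andP[ix xi] /andP[jx xj].
have N0 : 0 < N%:R :> R by rewrite ltr0n (leq_ltn_trans _ (ltn_ord i)).
have ijN (a b : nat) : a%:R / N%:R < b.+1%:R / N%:R :> R -> (a <= b)%N.
  by rewrite ltr_pM2r ?invr_gt0// ltr_nat ltnS.
apply/val_inj/eqP; rewrite eqn_leq.
by rewrite (ijN _ _ (lt_le_trans ix xj)) (ijN _ _ (lt_le_trans jx xi)).
Qed.

Lemma Rintegral_cell_indic (R : realType) (N k j : nat) : (j < N)%N ->
  \int[leb01 R]_(x in cell R N j) \1_(`[0, k%:R / N%:R]) x = (j < k)%:R / N%:R.
Proof.
move=> jN; have N0 : 0 < N%:R :> R by rewrite ltr0n (leq_ltn_trans _ jN).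
rewrite /Rintegral integral_indic//; last exact: measurable_cell.
case: ltnP => [jk|kj].
  rewrite setIidr ?leb01_cell// ?mul1r//.
  move=> x; rewrite /cell /= !in_itv/= => /andP[/ltW jx xj]; apply/andP; split.
    by rewrite (le_trans _ jx)// divr_ge0.
  by rewrite (le_trans xj)// ler_pM2r ?invr_gt0// ler_nat.
rewrite (_ : _ `&` _ = set0) ?measure0 ?mul0r//.
apply/seteqP; split => x //; rewrite /cell /= !in_itv/=.
move=> -[/andP[_ xk] /andP[jx _]].
have := lt_le_trans jx xk; rewrite ltr_pM2r ?invr_gt0// ltr_nat.
by rewrite ltnNge kj.
Qed.

Lemma integrable_cell (R : realType) (N j : nat) (f : measurableTypeR R -> R) :
  f \in Lfun (leb01 R) 2%:E -> (leb01 R).-integrable (cell R N j) (EFin \o f).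
Proof.
move=> /(Lfun_subset12 (leb01T_fin_num R))/Lfun1_integrable.
by apply: integrableS => //; exact: measurable_cell.
Qed.

Lemma ae_eq_Rintegral_cell (R : realType) (N j : nat)
    (f g : measurableTypeR R -> R) :
  f \in Lfun (leb01 R) 2%:E -> measurable_fun setT g ->
  {ae leb01 R, forall x, f x = g x} ->
  \int[leb01 R]_(x in cell R N j) f x = \int[leb01 R]_(x in cell R N j) g x.
Proof.
move=> f2 mg fg; rewrite /Rintegral; congr fine.
apply: ae_eq_integral; first exact: measurable_cell.
- exact: measurable_int (integrable_cell N j f2).
- by apply: measurable_funTS; exact/measurable_EFinP.
- by move: fg; apply: filterS => x /= ->.
Qed.

(** The average of [f] over the [j]-th cell: the cell has measure [1/N]. *)
Definition cellcoef (R : realType) (N : nat) (f : measurableTypeR R -> R)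
    (j : nat) : R :=
  N%:R * \int[leb01 R]_(x in cell R N j) f x.

Lemma cellcoefB (R : realType) (N j : nat) (f g : L2 R) :
  cellcoef N (fun x => f x - g x) j = cellcoef N f j - cellcoef N g j.
Proof.
rewrite /cellcoef RintegralB ?mulrBr//; first exact: measurable_cell.
  exact: integrable_cell (L2_Lfun2 f).
exact: integrable_cell (L2_Lfun2 g).
Qed.

(** [P] is linear only up to null sets, which integrals do not see. *)
Lemma cellcoef_linear (R : realType) (V : lmodType R) (P : V -> L2 R)
    (N j : nat) (a : R) (u v : V) : L2_linear P ->
  cellcoef N (P (a *: u + v)) j = a * cellcoef N (P u) j + cellcoef N (P v) j.
Proof.
move=> /(_ a u v) Plin.
have iu := integrable_cell N j (L2_Lfun2 (P u)).
have iv := integrable_cell N j (L2_Lfun2 (P v)).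
have mc := @measurable_cell R N j.
rewrite /cellcoef (ae_eq_Rintegral_cell N j (L2_Lfun2 _) _ Plin); last first.
  have [mu mv] : measurable_fun setT (P u) /\ measurable_fun setT (P v).
    by split; [have := L2_Lfun2 (P u)|have := L2_Lfun2 (P v)];
      rewrite inE => /andP[]; rewrite inE.
  by apply: measurable_funD => //; exact: measurable_funM.
rewrite RintegralD//; last exact: (integrableZl mc a iu).
by rewrite RintegralZl// mulrDr mulrCA.
Qed.

Lemma cellcoef_indic (R : realType) (N k j : nat) (f : L2 R) : (j < N)%N ->
  {ae leb01 R, forall x, f x = \1_(`[0, k%:R / N%:R]) x} ->
  cellcoef N f j = (j < k)%:R.
Proof.
move=> jN fk; rewrite /cellcoef (ae_eq_Rintegral_cell N j (L2_Lfun2 f) _ fk).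
  rewrite Rintegral_cell_indic// mulrCA mulfV ?mulr1//.
  by rewrite pnatr_eq0 -lt0n (leq_ltn_trans _ jN).
by apply: measurable_indic; exact: measurable_itv.
Qed.

(** Bessel's inequality for the cells: the squared Euclidean norm of the vector
    of cell averages of a function is at most [N] times its squared L^2 norm. *)
Lemma sum_sqr_cellcoef (R : realType) (N : nat) (f g : L2 R) (d : R) :
  (0 < N)%N -> 0 <= d -> (L2dist f g <= d%:E)%E ->
  \sum_(j < N) cellcoef N (fun x => f x - g x) j ^+ 2 <= N%:R * d ^+ 2.
Proof.
move=> N0 d0 fgd; have N0' : 0 < N%:R :> R by rewrite ltr0n.
under eq_bigr do rewrite /cellcoef exprMn.
rewrite -mulr_sumr expr2 -mulrA ler_pM2l// -ler_pdivlMl//.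
apply: (@le_trans _ _ (N%:R^-1 * \int[leb01 R]_x ((f x - g x) ^+ 2))).
  apply: bessel_disjoint.
  - by move=> i; exact: measurable_cell.
  - exact: trivIset_cell.
  - by move=> i; exact: leb01_cell.
  - by rewrite invr_gt0.
  - apply/Lfun1_integrable/(Lfun_subset12 (leb01T_fin_num R)).
    exact: L2B_Lfun2.
  - exact: Lfun2_integrable_sqr (L2B_Lfun2 f g).
by rewrite ler_pM2l ?invr_gt0//; exact: Rintegral_sqr_L2dist.
Qed.

(** * The width of the family of interval indicators *)

(** If points [P (y k)] of an [n]-dimensional space are within [d] of the
    indicators [h k] of the intervals [[0,k/N]], [k = 0..N], then [d] is not
    much smaller than [N^(-1/2)], unless [n] is close to [N]. *)
Lemma interval_width (R : realType) (n N : nat) (y : nat -> 'rV[R]_n)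
    (P : 'rV[R]_n -> L2 R) (h : nat -> L2 R) (d : R) :
  L2_linear P -> (0 < N)%N -> 0 <= d ->
  (forall k, (k <= N)%N ->
    {ae leb01 R, forall x, h k x = \1_(`[0, k%:R / N%:R]) x}) ->
  (forall k, (k <= N)%N -> (L2dist (h k) (P (y k)) <= d%:E)%E) ->
  N%:R - n%:R <= 4 * N%:R ^+ 2 * d ^+ 2.
Proof.
move=> Plin N0 d0 hk hd.
have [M PM] : exists M : 'M[R]_(n, N),
    forall u, \row_j cellcoef N (P u) j = u *m M.
  apply: linear_rV_mulmx => a u v; apply/rowP => j.
  by rewrite !mxE cellcoef_linear.
pose c k j := cellcoef N (fun x => h k x - P (y k) x) j.
have sumc k : (k <= N)%N -> \sum_(j < N) c k j ^+ 2 <= N%:R * d ^+ 2.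
  by move=> kN; exact: sum_sqr_cellcoef N0 d0 (hd k kN).
(* Factoring through dimension [n] bounds the rank of [A]. *)
pose A := (\matrix_(k < N) (y k.+1 - y k)) *m M.
have EA (k j : 'I_N) : (1%:M - A) k j = c k.+1 j - c k j.
  have AE : A k j = cellcoef N (P (y k.+1)) j - cellcoef N (P (y k)) j.
    transitivity ((row k A) 0 j); first by rewrite [RHS]mxE.
    by rewrite row_mul rowK mulmxBl -!PM !mxE.
  have -> : (1%:M - A) k j = (k == j)%:R - A k j by rewrite !mxE.
  rewrite AE /c !cellcoefB.
  rewrite (cellcoef_indic (ltn_ord j) (hk _ (ltn_ord k))).
  rewrite (cellcoef_indic (ltn_ord j) (hk _ (ltnW (ltn_ord k)))).
  suff -> : (k == j)%:R = (j < k.+1)%:R - (j < k)%:R :> R by ring.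
  rewrite ltnS leq_eqVlt -val_eqE /= eq_sym.
  by case: ltngtP => //=; rewrite ?subrr ?subr0.
have rankA : (\rank A)%:R <= n%:R :> R by rewrite ler_nat mulmx_max_rank.
apply: le_trans (_ : N%:R - (\rank A)%:R <= _); first by rewrite lerB.
apply: le_trans (subr_rank_le_frobenius A) _.
apply: (@le_trans _ _ (\sum_(k < N) 4 * N%:R * d ^+ 2)); last first.
  by rewrite sumr_const card_ord -mulr_natr; lra.
apply: ler_sum => k _.
apply: (@le_trans _ _ (\sum_(j < N) (2 * c k.+1 j ^+ 2 + 2 * c k j ^+ 2))).
  apply: ler_sum => j _; rewrite EA.
  have := sqr_ge0 (c k.+1 j + c k j); lra.
rewrite big_split/= -!mulr_sumr.
have := sumc _ (ltn_ord k); have := sumc _ (ltnW (ltn_ord k)); lra.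
Qed.

Theorem theorem4p1 (R : realType) :
  exists2 C1 : R, 0 < C1 &
    forall (n : nat) (m : 'I_n -> L2 R -> R) (P : 'rV[R]_n -> L2 R),
      (1 <= n)%N -> L2_linear P ->
      exists2 f : L2 R, calH f &
        ((C1 / Num.sqrt n%:R)%:E <= L2dist f (P (\row_i m i f)))%E.
Proof.
exists 5^-1; first by rewrite invr_gt0.
move=> n m P n1 Plin; apply: contrapT => nof.
set d := 5^-1 / Num.sqrt n%:R in nof *.
have n0 : 0 < n%:R :> R by rewrite ltr0n.
have d0 : 0 <= d by rewrite divr_ge0 ?invr_ge0 ?sqrtr_ge0.
have small f : calH f -> (L2dist f (P (\row_i m i f)) <= d%:E)%E.
  by move=> fH; rewrite leNgt; apply/negP => /ltW df; apply: nof; exists f.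
pose N := n.*2; have N0 : (0 < N)%N by rewrite double_gt0.
have /choice[h hP] (k : nat) : exists f : L2 R, (k <= N)%N ->
    calH f /\ {ae leb01 R, forall x, f x = \1_(`[0, k%:R / N%:R]) x}.
  have [kN|kN] := leqP k N; last first.
    by exists (P 0).
  have [|f fH fk] := @calH_indic R (k%:R / N%:R); last by exists f.
  by rewrite divr_ge0//= ler_pdivrMr ?ltr0n// mul1r ler_nat.
have := interval_width (y := fun k => \row_i m i (h k)) Plin N0 d0
  (fun k kN => (hP k kN).2) (fun k kN => small _ (hP k kN).1).
have -> : d ^+ 2 = 25^-1 / n%:R.
  by rewrite /d expr_div_n sqr_sqrtr ?ler0n// exprVn -natrX.
have -> : N%:R = 2 * n%:R :> R by rewrite /N -mul2n natrM.
have -> : 4 * (2 * n%:R) ^+ 2 * (25^-1 / n%:R) = 16 / 25 * n%:R :> R.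
  by field; rewrite gt_eqF.
lra.
Qed.
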